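(* Suppose $f=\frac1n\sum_{i=1}^n f_i$ is $\mu$-strongly convex and each $f_i$ has $L$-Lipschitz continuous gradient; let $\kappa=\frac L\mu$. Let $\mathbf{W}$ be a mixing matrix with $\mathbf{W}\ne\frac{1_n1_n^T}{n}$, let $n_c\ge1$, and consider the methods GTA-1, GTA-2, GTA-3 with $n_g=1$ described in the context, with step size $\alpha>0$. If the following step size conditions hold: - for GTA-1: $\displaystyle \alpha<\min\left\{\frac{1-\beta^{n_c}}{L},\ \frac{3-\beta^{n_c}}{2\kappa(L+\mu)}\left(\sqrt{1+4(\kappa+1)\left(\frac{1-\beta^{n_c}}{3-\beta^{n_c}}\right)^2}-1\right)\right\}$, - for GTA-2: $\displaystyle \alpha<\min\left\{\frac{1-\beta^{n_c}}{L},\ \frac{1+\beta^{n_c}}{2\kappa(L+\mu)\beta^{n_c}}\left(\sqrt{1+4(\kappa+1)\beta^{n_c}\left(\frac{1-\beta^{n_c}}{1+\beta^{n_c}}\right)^2}-1\right)\right\}$, - for GTA-3: $\displaystyle \alpha<\min\left\{\frac1L,\ \frac{1-\beta^{n_c}}{L\beta^{n_c}},\ \frac{1+\beta^{n_c}}{2\kappa(L+\mu)\beta^{n_c}}\left(\sqrt{1+4(\kappa+1)\left(\frac{1-\beta^{n_c}}{1+\beta^{n_c}}\right)^2}-1\right)\right\}$, then, for each $i=1,2,3$ (the error vectors $r_k$ being those of GTA-$i$ run with its step size), $\rho(A_i(n_c))<1$ and for all $\epsilon>0$ there exists a constant $C_{i,\epsilon}>0$ such that, for all $k\ge0$, $$\|r_k\|_2\le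 C_{i,\epsilon}\left(\rho(A_i(n_c))+\epsilon\right)^k\|r_0\|_2.$$
   Context: Functions: $f_i:\mathbb{R}^d\to\mathbb{R}$, $i=1,\dots,n$, are differentiable, $f=\frac1n\sum_{i=1}^n f_i$. $\mu$-strong convexity ($\mu>0$) means $f(z')\ge f(z)+\langle\nabla f(z),z'-z\rangle+\frac{\mu}{2}\|z'-z\|_2^2$ for all $z,z'\in\mathbb{R}^d$; $L$-Lipschitz gradients means $\|\nabla f_i(z)-\nabla f_i(z')\|_2\le L\|z-z'\|_2$ for all $z,z'$ and all $i$. $x^*$ is the unique minimizer of $f$. $\rho(\cdot)$ denotes spectral radius. The $n$ nodes form a connected undirected network with edge set $\mathcal{E}$. A mixing matrix $\mathbf{W}\in\mathbb{R}^{n\times n}$ is a symmetric doubly stochastic matrix with $w_{ii}>0$ and, for $i\ne j$, $w_{ij}>0$ if and only if $(i,j)\in\mathcal{E}$ (and $w_{ij}=0$ otherwise); $\beta=\|\mathbf{W}-\frac{1_n1_n^T}{n}\|_2\in[0,1)$. Algorithm (with $n_g=1$): for $\mathbf{x}=(x_1,\dots,x_n)\in\mathbb{R}^{nd}$ write $\nabla\mathbf{f}(\mathbf{x})=(\nabla f_1(x_1),\dots,\nabla f_n(x_n))$. Given $\mathbf{x}_0\in\mathbb{R}^{nd}$ arbitrary and $\mathbf{y}_0=\nabla\mathbf{f}(\mathbf{x}_0)$, for $k\ge0$: $\mathbf{x}_{k+1}=\mathbf{Z}_1^{n_c}\mathbf{x}_k-\alpha\mathbf{Z}_2^{n_c}\mathbf{y}_k$,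 $\ \mathbf{y}_{k+1}=\mathbf{Z}_3^{n_c}\mathbf{y}_k+\mathbf{Z}_4^{n_c}(\nabla\mathbf{f}(\mathbf{x}_{k+1})-\nabla\mathbf{f}(\mathbf{x}_k))$, where $\mathbf{Z}_i=\mathbf{W}_i\otimes I_d$ and $(\mathbf{W}_1,\mathbf{W}_2,\mathbf{W}_3,\mathbf{W}_4)$ equals $(\mathbf{W},I_n,\mathbf{W},I_n)$ for GTA-1, $(\mathbf{W},\mathbf{W},\mathbf{W},I_n)$ for GTA-2, and $(\mathbf{W},\mathbf{W},\mathbf{W},\mathbf{W})$ for GTA-3. Error vector: $\bar x_k=\frac1n\sum_i x_{i,k}$, $\bar y_k=\frac1n\sum_i y_{i,k}$; $\bar{\mathbf{x}}_k,\bar{\mathbf{y}}_k\in\mathbb{R}^{nd}$ are $\bar x_k,\bar y_k$ repeated $n$ times; $r_k=\left(\|\bar x_k-x^*\|_2,\ \|\mathbf{x}_k-\bar{\mathbf{x}}_k\|_2,\ \|\mathbf{y}_k-\bar{\mathbf{y}}_k\|_2\right)^T$. Matrices: $$A_1(n_c)=\begin{bmatrix}1-\alpha\mu&\frac{\alpha L}{\sqrt n}&0\\0&\beta^{n_c}&\alpha\\ \sqrt n\alpha L^2&L(2+\alpha L)&\beta^{n_c}+\alpha L\end{bmatrix},\quad A_2(n_c)=\begin{bmatrix}1-\alpha\mu&\frac{\alpha L}{\sqrt n}&0\\0&\beta^{n_c}&\alpha\beta^{n_c}\\ \sqrt n\alpha L^2&L(2+\alpha L)&\beta^{n_c}+\alpha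 L\end{bmatrix},$$ $$A_3(n_c)=\begin{bmatrix}1-\alpha\mu&\frac{\alpha L}{\sqrt n}&0\\0&\beta^{n_c}&\alpha\beta^{n_c}\\ \beta^{n_c}\sqrt n\alpha L^2&\beta^{n_c}L(2+\alpha L)&\beta^{n_c}(1+\alpha L)\end{bmatrix}.$$ *)

(* Defs.v *)
From mathcomp Require Import all_boot all_order all_algebra.
From mathcomp Require Import complex mxtens.
From mathcomp Require Import all_classical all_reals all_analysis.
Set Implicit Arguments.
Unset Strict Implicit.
Unset Printing Implicit Defensive.
Import Order.TTheory GRing.Theory Num.Theory.
Import numFieldNormedType.Exports.
Local Open Scope classical_set_scope.
Local Open Scope ring_scope.

Section EuclideanSpace.
Context {R : realType}.

Definition dotv d (u v : 'cV[R]_d) : R := \sum_(i < d) u i 0 * v i 0.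

(* The library norm `|v| on matrices is the sup norm, hence this definition. *)
Definition norm2 d (v : 'cV[R]_d) : R := Num.sqrt (\sum_(i < d) v i 0 ^+ 2).

Definition mxnorm2 n (M : 'M[R]_n) : R :=
  sup [set norm2 (M *m v) | v in [set v : 'cV[R]_n | norm2 v <= 1]].

(* The eigenvalues are the complex ones: M is viewed as a matrix over R[i]. *)
Definition spectral_radius n (M : 'M[R]_n) : R :=
  sup [set Normc.normc l | l in
    [set l : R[i] | eigenvalue (map_mx (real_complex R) M) l]].

Definition gradient d (f : 'cV[R]_d -> R) (z : 'cV[R]_d) : 'cV[R]_d :=
  \col_(j < d) 'D_(delta_mx j 0) f z.

Definition strongly_convex d (mu : R) (f : 'cV[R]_d -> R) : Prop :=
  forall z z' : 'cV[R]_d,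
    f z + dotv (gradient f z) (z' - z) + mu / 2 * norm2 (z' - z) ^+ 2 <= f z'.

Definition lipschitz_gradient d (L : R) (f : 'cV[R]_d -> R) : Prop :=
  forall z z' : 'cV[R]_d,
    norm2 (gradient f z - gradient f z') <= L * norm2 (z - z').

Definition is_minimizer d (f : 'cV[R]_d -> R) (xstar : 'cV[R]_d) : Prop :=
  forall z, f xstar <= f z.

Definition average_fun n d (f : 'I_n -> 'cV[R]_d -> R) (z : 'cV[R]_d) : R :=
  n%:R^-1 * \sum_(i < n) f i z.

End EuclideanSpace.

Section Network.
Context {R : realType}.

Definition connected_network n (E : rel 'I_n) : Prop :=
  symmetric E /\ forall i j, connect E i j.

Definition doubly_stochastic n (W : 'M[R]_n) : Prop :=
  [/\ forall i j, 0 <= W i j,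
      forall i, \sum_(j < n) W i j = 1 &
      forall j, \sum_(i < n) W i j = 1].

Definition mixing_matrix n (E : rel 'I_n) (W : 'M[R]_n) : Prop :=
  [/\ W^T = W,
      doubly_stochastic W,
      forall i, 0 < W i i,
      forall i j, i != j -> (0 < W i j <-> E i j) &
      forall i j, i != j -> ~~ E i j -> W i j = 0].

(* 1_n 1_n^T / n *)
Definition averaging_mx n : 'M[R]_n := const_mx n%:R^-1.

Definition mixing_rate n (W : 'M[R]_n) : R := mxnorm2 (W - averaging_mx n).

End Network.

Section StackedVectors.
Context {R : realType}.
Variables n d : nat.

(* Indices of R^(nd) are those of the tensor product of mxtens, so that node i
   owns the coordinates mxtens_index (i, j) = i * d + j, j < d. *)
Definition block (x : 'cV[R]_(n * d)) (i : 'I_n) : 'cV[R]_d :=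
  \col_(j < d) x (mxtens_index (i, j)) 0.

Definition stack (v : 'I_n -> 'cV[R]_d) : 'cV[R]_(n * d) :=
  \col_(k < n * d) v (mxtens_unindex k).1 (mxtens_unindex k).2 0.

Definition stacked_gradient (f : 'I_n -> 'cV[R]_d -> R)
    (x : 'cV[R]_(n * d)) : 'cV[R]_(n * d) :=
  stack (fun i => gradient (f i) (block x i)).

Definition block_mean (x : 'cV[R]_(n * d)) : 'cV[R]_d :=
  n%:R^-1 *: \sum_(i < n) block x i.

Definition consensus (x : 'cV[R]_(n * d)) : 'cV[R]_(n * d) :=
  stack (fun=> block_mean x).

Definition error_vector (xstar : 'cV[R]_d) (x y : 'cV[R]_(n * d)) : 'cV[R]_3 :=
  \col_(i < 3) [:: norm2 (block_mean x - xstar);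
                   norm2 (x - consensus x);
                   norm2 (y - consensus y)]`_i.

End StackedVectors.

Inductive gta := GTA1 | GTA2 | GTA3.

Section GradientTracking.
Context {R : realType}.

Definition gta_matrices n (m : gta) (W : 'M[R]_n) :
    'M[R]_n * 'M[R]_n * 'M[R]_n * 'M[R]_n :=
  match m with
  | GTA1 => (W, 1%:M, W, 1%:M)
  | GTA2 => (W, W, W, 1%:M)
  | GTA3 => (W, W, W, W)
  end.

(* x and y are the iterates with n_c communication steps and one gradient step
   per iteration; the starting point x 0 is unconstrained. *)
Definition gta_iterates n d (m : gta) (f : 'I_n -> 'cV[R]_d -> R)
    (W : 'M[R]_n) (nc : nat) (alpha : R) (x y : nat -> 'cV[R]_(n * d)) : Prop :=
  let: (W1, W2, W3, W4) := gta_matrices m W in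
  let Z (V : 'M[R]_n) : 'M[R]_(n * d) := V *t (1%:M : 'M[R]_d) in
  y 0%N = stacked_gradient f (x 0%N) /\
  forall k : nat,
    x k.+1 = Z W1 ^+ nc *m x k - alpha *: (Z W2 ^+ nc *m y k) /\
    y k.+1 = Z W3 ^+ nc *m y k +
      Z W4 ^+ nc *m (stacked_gradient f (x k.+1) - stacked_gradient f (x k)).

(* b stands for beta ^+ nc. *)
Definition gta_error_mx (m : gta) (n : nat) (mu L alpha b : R) : 'M[R]_3 :=
  let s := Num.sqrt n%:R in
  let rows :=
    match m with
    | GTA1 =>
      [:: [:: 1 - alpha * mu; alpha * L / s; 0];
          [:: 0; b; alpha];
          [:: s * alpha * L ^+ 2; L * (2 + alpha * L); b + alpha * L]]
    | GTA2 =>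
      [:: [:: 1 - alpha * mu; alpha * L / s; 0];
          [:: 0; b; alpha * b];
          [:: s * alpha * L ^+ 2; L * (2 + alpha * L); b + alpha * L]]
    | GTA3 =>
      [:: [:: 1 - alpha * mu; alpha * L / s; 0];
          [:: 0; b; alpha * b];
          [:: b * s * alpha * L ^+ 2; b * L * (2 + alpha * L);
              b * (1 + alpha * L)]]
    end in
  \matrix_(i < 3, j < 3) (nth [::] rows i)`_j.

Definition gta_step_bound (m : gta) (mu L b : R) : R :=
  let kappa := L / mu in
  match m with
  | GTA1 =>
    Num.min ((1 - b) / L)
      ((3 - b) / (2 * kappa * (L + mu)) *
       (Num.sqrt (1 + 4 * (kappa + 1) * ((1 - b) / (3 - b)) ^+ 2) - 1))
  | GTA2 =>
    Num.min ((1 - b) / L)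
      ((1 + b) / (2 * kappa * (L + mu) * b) *
       (Num.sqrt (1 + 4 * (kappa + 1) * b * ((1 - b) / (1 + b)) ^+ 2) - 1))
  | GTA3 =>
    Num.min (1 / L) (Num.min ((1 - b) / (L * b))
      ((1 + b) / (2 * kappa * (L + mu) * b) *
       (Num.sqrt (1 + 4 * (kappa + 1) * ((1 - b) / (1 + b)) ^+ 2) - 1)))
  end.

End GradientTracking.

(* Main.v *)
Require Import Defs.
From mathcomp Require Import all_boot all_order all_algebra.
From mathcomp Require Import complex mxtens.
From mathcomp Require Import all_classical all_reals all_analysis.
From mathcomp Require Import ring lra.
Import Order.TTheory GRing.Theory Num.Theory.
Import numFieldNormedType.Exports.
Local Open Scope ring_scope.
Set Implicit Arguments.
Unset Strict Implicit.
Unset Printing Implicit Defensive.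

(** One iteration bounds the three errors by a nonnegative linear recursion,
entrywise r (k+1) <= A r k. The mean iterate performs a gradient step on the
average function, which contracts the distance to the minimizer by
1 - alpha mu (gradient_step_contraction), perturbed by the consensus error
(optimality_error_step). A communication step contracts deviations from the
mean by the mixing rate (mixing_matrix_operator), which gives the second row
(consensus_error_step). For the third row, gradient tracking keeps the mean of y
equal to the mean of the local gradients (tracking_step), so the displacement
of x, hence the change of the gradients, is controlled by the three errors
(displacement_le, tracking_error_step). The three methods differ only in the
contraction factors p and q of two of their mixing operators (gta_rates), so
the analysis is done once with p and q as parameters.

Two facts about nonnegative matrices then finish the proof. First, a positive
vector v with A v < v entrywise forces the spectral radius below 1
(nonneg_spectral_radius_lt1). For this A such a vector exists as soon as
det (I - A) > 0 and the diagonal entries are below 1; the determinant is, up to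
a positive factor, a quadratic in alpha with positive root the one in the step
size bound (gta_step_conditions, gta_spectral_radius_lt1). Second, the entries of
A^k are at most C t^k for each t above the spectral radius, by Cayley-Hamilton
and one scalar recursion per eigenvalue (spectral_radius_power_bound), and this
transfers to the errors since A is nonnegative (nonneg_recursion_rate). *)

(** * Euclidean norm *)

Section EuclideanNorm.
Context {R : realType} {d : nat}.
Implicit Types u v w : 'cV[R]_d.

Lemma dotvC u v : dotv u v = dotv v u.
Proof. by apply: eq_bigr => i _; rewrite mulrC. Qed.

Lemma dotvDl u v w : dotv (u + v) w = dotv u w + dotv v w.
Proof. by rewrite -big_split; apply: eq_bigr => i _; rewrite mxE mulrDl. Qed.

Lemma dotvZl a u w : dotv (a *: u) w = a * dotv u w.
Proof. by rewrite mulr_sumr; apply: eq_bigr => i _; rewrite mxE mulrA. Qed.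

Lemma dotvNl u w : dotv (- u) w = - dotv u w.
Proof. by rewrite -scaleN1r dotvZl mulN1r. Qed.

Lemma dotvDr u v w : dotv w (u + v) = dotv w u + dotv w v.
Proof. by rewrite !(dotvC w) dotvDl. Qed.

Lemma dotvZr a u w : dotv w (a *: u) = a * dotv w u.
Proof. by rewrite !(dotvC w) dotvZl. Qed.

Lemma dotvNr u w : dotv w (- u) = - dotv w u.
Proof. by rewrite !(dotvC w) dotvNl. Qed.

Lemma dot0v w : dotv 0 w = 0.
Proof. by rewrite -(scale0r 0) dotvZl mul0r. Qed.

Definition dotvE := (dotvDl, dotvDr, dotvNl, dotvNr, dotvZl, dotvZr).

Lemma norm2_ge0 v : 0 <= norm2 v.
Proof. exact: sqrtr_ge0. Qed.

Lemma norm2_sqrE v : norm2 v ^+ 2 = \sum_(i < d) v i 0 ^+ 2.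
Proof. by rewrite sqr_sqrtr// sumr_ge0// => i _; rewrite sqr_ge0. Qed.

Lemma norm2_sqr v : norm2 v ^+ 2 = dotv v v.
Proof. by rewrite norm2_sqrE; apply: eq_bigr => i _; rewrite expr2. Qed.

Lemma norm2_le_sqr v a : 0 <= a -> (norm2 v <= a) = (norm2 v ^+ 2 <= a ^+ 2).
Proof. by move=> a0; rewrite ler_sqr ?nnegrE ?norm2_ge0. Qed.

Lemma norm2_eq0 v : norm2 v = 0 -> v = 0.
Proof.
move=> v0; apply/matrixP => i j; rewrite ord1 mxE.
have /eqP := norm2_sqrE v; rewrite v0 expr0n /= eq_sym psumr_eq0.
  by move=> /allP /(_ i (mem_index_enum i)) /=; rewrite sqrf_eq0 => /eqP.
by move=> k _; rewrite sqr_ge0.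
Qed.

Lemma norm2_0 : norm2 (0 : 'cV[R]_d) = 0.
Proof. by apply/eqP; rewrite -sqrf_eq0 norm2_sqr dot0v. Qed.

Lemma norm2Z a v : norm2 (a *: v) = `|a| * norm2 v.
Proof.
apply/eqP; rewrite -(@eqrXn2 _ 2) ?mulr_ge0 ?norm2_ge0//.
by rewrite exprMn !norm2_sqr real_normK ?num_real// !dotvE mulrA.
Qed.

Lemma norm2N v : norm2 (- v) = norm2 v.
Proof. by rewrite -scaleN1r norm2Z normrN1 mul1r. Qed.

Lemma norm2_distC u v : norm2 (u - v) = norm2 (v - u).
Proof. by rewrite -norm2N opprB. Qed.

Lemma dotv_le u v : dotv u v <= norm2 u * norm2 v.
Proof.
have [u0|u_neq0] := eqVneq (norm2 u) 0.
  by rewrite u0 (norm2_eq0 u0) dot0v mul0r.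
have [v0|v_neq0] := eqVneq (norm2 v) 0.
  by rewrite v0 (norm2_eq0 v0) dotvC dot0v mulr0.
have u_gt0 : 0 < norm2 u by rewrite lt_def u_neq0 norm2_ge0.
have v_gt0 : 0 < norm2 v by rewrite lt_def v_neq0 norm2_ge0.
have := sqr_ge0 (norm2 (norm2 v *: u - norm2 u *: v)).
rewrite norm2_sqr !dotvE (dotvC v u) -!norm2_sqr => H.
rewrite -(ler_pM2l (mulr_gt0 u_gt0 v_gt0)); lra.
Qed.

Lemma norm2D u v : norm2 (u + v) <= norm2 u + norm2 v.
Proof.
rewrite norm2_le_sqr ?addr_ge0 ?norm2_ge0// norm2_sqr !dotvE (dotvC v u).
rewrite -!norm2_sqr; have := dotv_le u v; lra.
Qed.

Lemma norm2B u v : norm2 (u - v) <= norm2 u + norm2 v.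
Proof. by rewrite -(norm2N v) norm2D. Qed.

Lemma norm2_sum (I : Type) (r : seq I) (F : I -> 'cV[R]_d) :
  norm2 (\sum_(i <- r) F i) <= \sum_(i <- r) norm2 (F i).
Proof.
elim/big_ind2: _ => [|a u b v au bv|//]; first by rewrite norm2_0.
exact: le_trans (norm2D u v) (lerD au bv).
Qed.

Lemma norm2_sumZ_sqr (a : 'I_d -> R) v :
  (\sum_i a i * v i 0) ^+ 2 <= (\sum_i a i ^+ 2) * norm2 v ^+ 2.
Proof.
pose u : 'cV[R]_d := \col_i a i.
have -> : \sum_i a i * v i 0 = dotv u v by apply: eq_bigr => i _; rewrite mxE.
have -> : \sum_i a i ^+ 2 = norm2 u ^+ 2.
  by rewrite norm2_sqrE; apply: eq_bigr => i _; rewrite mxE.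
have H := dotv_le u v; have := dotv_le (- u) v; rewrite dotvNl norm2N => H'.
rewrite -exprMn -ler_sqrt ?sqr_ge0// !sqrtr_sqr ler_norml.
by rewrite (ger0_norm (mulr_ge0 _ _)) ?norm2_ge0// lerNl H' H.
Qed.

Lemma coord_le_norm2 v i : `|v i 0| <= norm2 v.
Proof.
rewrite -sqrtr_sqr ler_wsqrtr// (bigD1 i)//= lerDl.
by rewrite sumr_ge0// => k _; rewrite sqr_ge0.
Qed.

Lemma norm2_le_sum v : norm2 v <= \sum_i `|v i 0|.
Proof.
rewrite norm2_le_sqr ?sumr_ge0// norm2_sqrE expr2 mulr_suml ler_sum// => i _.
rewrite -real_normK ?num_real// expr2 ler_wpM2l// (bigD1 i)//= lerDl.
by rewrite sumr_ge0.
Qed.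

End EuclideanNorm.

(** * Smooth strongly convex functions *)

Lemma le_of_geometric_slack {R : realType} (a b c : R) :
  (forall k : nat, a <= b + c * 2^-1 ^+ k) -> a <= b.
Proof.
move=> H; rewrite leNgt; apply/negP => ba.
have ab_gt0 : 0 < a - b by rewrite subr_gt0.
pose k := Num.bound (`|c| / (a - b)).
have /archi_boundP : 0 <= `|c| / (a - b) by rewrite divr_ge0// ltW.
rewrite -/k ltr_pdivrMr// => ck.
have k2 : k%:R <= 2 ^+ k :> R by rewrite -natrX ler_nat ltnW// ltn_expl.
have := H k; rewrite exprVn -lerBlDl -ler_pdivrMr ?invr_gt0 ?exprn_gt0//.
rewrite invrK => {}H; have := ler_norm c; have := ler_wpM2r (ltW ab_gt0) k2.
by lra.
Qed.

Section SmoothStronglyConvex.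
Context {R : realType} {d : nat}.
Variables (f : 'cV[R]_d -> R) (mu L : R).
Hypothesis (f_sc : strongly_convex mu f) (f_lip : lipschitz_gradient L f).
Hypothesis mu_gt0 : 0 < mu.
Notation g := (gradient f).

Lemma gradient_strongly_monotone z z' :
  mu * norm2 (z - z') ^+ 2 <= dotv (g z - g z') (z - z').
Proof.
have := f_sc z z'; have := f_sc z' z.
by rewrite !norm2_sqr !dotvE !(dotvC z'); lra.
Qed.

Lemma gradient_dotv_le z z' :
  dotv (g z - g z') (z - z') <= L * norm2 (z - z') ^+ 2.
Proof.
by apply: le_trans (dotv_le _ _) _; rewrite expr2 mulrA ler_wpM2r ?norm2_ge0//.
Qed.

Lemma strong_convexity_le_smoothness : (0 < d)%N -> mu <= L.
Proof.
move=> d_gt0; pose e : 'cV[R]_d := const_mx 1.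
have e_gt0 : 0 < norm2 e ^+ 2.
  rewrite norm2_sqrE (eq_bigr (fun=> 1)); last by move=> i _; rewrite mxE expr1n.
  by rewrite sumr_const card_ord ltr0n.
have := le_trans (gradient_strongly_monotone e 0) (gradient_dotv_le e 0).
by rewrite subr0 ler_pM2r.
Qed.

(** Convexity, read at the endpoint z + v, together with the Lipschitz gradient
gives the quadratic upper bound with constant L. Bounding the two halves of
the segment separately halves the distance of that constant to L / 2. *)
Lemma descent_dyadic k z v :
  f (z + v) <= f z + dotv (g z) v + (L / 2 + L / 2 * 2^-1 ^+ k) * norm2 v ^+ 2.
Proof.
elim: k z v => [|k IH] z v.
  have := f_sc (z + v) z; have := gradient_dotv_le (z + v) z.
  rewrite opprD addrA subrr sub0r (addrC z v) addrK norm2N dotvNr dotvDl dotvNl.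
  by rewrite expr0; have := mulr_ge0 (ltW mu_gt0) (sqr_ge0 (norm2 v)); lra.
pose w := 2^-1 *: v.
have vw : v = w + w by rewrite -scalerDl -div1r -splitr scale1r.
have nw : norm2 v ^+ 2 = 4 * norm2 w ^+ 2.
  by rewrite !norm2_sqr vw !dotvE; ring.
move: w vw nw => w vw nw.
have := IH (z + w) w; have := IH z w; have := gradient_dotv_le (z + w) z.
have -> : z + w - z = w by rewrite addrC addKr.
by rewrite nw vw addrA !dotvE (exprS _ k); lra.
Qed.

Lemma descent z z' :
  f z' <= f z + dotv (g z) (z' - z) + L / 2 * norm2 (z' - z) ^+ 2.
Proof.
apply: (@le_of_geometric_slack _ _ _ (L / 2 * norm2 (z' - z) ^+ 2)) => k.
by have := descent_dyadic k z (z' - z); rewrite addrC subrK; lra.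
Qed.

(** Moving from the minimizer against its gradient by t times that gradient
does not decrease f, so by convexity the gradient there has a nonpositive
component along the original one; but for small t it has not had room to
turn around unless it was zero. *)
Lemma minimizer_gradient xstar : is_minimizer f xstar -> g xstar = 0.
Proof.
move=> x_min.
(* The sign of L is unknown at this point; t only has to satisfy L * t <= 1/2. *)
pose t := (2 * (`|L| + 1))^-1.
have t_gt0 : 0 < t by rewrite invr_gt0 mulr_gt0// ltr_wpDl.
have tL : L * t <= 2^-1.
  rewrite /t invfM mulrCA ger_pMr ?invr_gt0// ler_pdivrMr ?ltr_wpDl//.
  by have := ler_norm L; lra.
pose u := xstar - t *: g xstar.
have ux : xstar - u = t *: g xstar by rewrite /u subKr.
have := f_sc u xstar; have := x_min u; have := f_lip xstar u.
have := dotv_le (g xstar - g u) (g xstar).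
rewrite ux norm2Z (gtr0_norm t_gt0) !dotvE -norm2_sqr.
set N := norm2 (g xstar); have N_ge0 : 0 <= N := norm2_ge0 _.
move=> H1 H2 H3 H4; apply: norm2_eq0; apply/eqP; rewrite eq_le N_ge0 andbT -/N.
have H5 : dotv (g u) (g xstar) <= 0.
  rewrite -(pmulr_rle0 _ t_gt0).
  have := sqr_ge0 (t * N); have := mu_gt0; nra.
have H6 : N ^+ 2 <= 2^-1 * N ^+ 2.
  have : norm2 (g xstar - g u) * N <= 2^-1 * N * N.
    by rewrite ler_wpM2r// (le_trans H2)// mulrA ler_wpM2r.
  by lra.
have : N ^+ 2 <= 0 by lra.
by rewrite real_exprn_even_le0//= ?num_real// => /eqP ->.
Qed.

(** Baillon-Haddad inequality for h = f - mu/2 |.|^2, which is convex and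
satisfies the quadratic upper bound with constant M. Comparing the tangent
plane of h at b with the upper bound at a, both at the point u that minimizes
the resulting quadratic, gives half of the inequality; exchanging a and b
gives the other half. *)
Lemma gradient_cocoercive M z z' : 0 < M -> L <= M + mu ->
  norm2 (g z - g z' - mu *: (z - z')) ^+ 2 <=
  M * dotv (g z - g z' - mu *: (z - z')) (z - z').
Proof.
move=> M_gt0 LM.
have half a b : norm2 (g a - g b - mu *: (a - b)) ^+ 2 <=
    2 * M * (f a - f b - dotv (g b) (a - b) - mu / 2 * norm2 (a - b) ^+ 2).
  set q := g a - g b - mu *: (a - b); pose u := a - M^-1 *: q.
  have ub : u - b = (a - b) - M^-1 *: q by rewrite addrAC.
  have ua : u - a = - (M^-1 *: q) by rewrite addrAC subrr sub0r.
  have ga : g a = g b + mu *: (a - b) + q by rewrite /q -addrA !subrKC.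
  have := f_sc b u; have := descent a u; rewrite ub ua ga.
  move: (f u) => fu; clear u ub ua ga; move: (a - b) q => D q.
  rewrite !norm2_sqr !dotvE (dotvC q D).
  have Q_ge0 : 0 <= dotv q q by rewrite -norm2_sqr sqr_ge0.
  have Ms : M * M^-1 = 1 by rewrite divff// gt_eqF.
  have s_gt0 : 0 < M^-1 by rewrite invr_gt0.
  move: (M^-1) Ms s_gt0 => s Ms s_gt0.
  have : (L - (M + mu)) * (s ^+ 2 * dotv q q) <= 0.
    by apply: mulr_le0_ge0; [rewrite subr_le0 | rewrite mulr_ge0// sqr_ge0].
  have Ms2 : M * s ^+ 2 = s by rewrite expr2 mulrA Ms mul1r.
  move=> H1 H2 H3.
  have : s * dotv q q <= 2 * (f a - f b - dotv (g b) D - mu / 2 * dotv D D).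
    have : M * s ^+ 2 * dotv q q = s * dotv q q by rewrite Ms2.
    by lra.
  rewrite -(ler_pM2l M_gt0) mulrA Ms mul1r; lra.
have := half z z'; have := half z' z; set q := g z - g z' - _.
have -> : g z' - g z - mu *: (z' - z) = - q.
  by rewrite /q opprD opprB -(opprB z z') scalerN.
have qe : dotv q (z - z') =
    dotv (g z) (z - z') - dotv (g z') (z - z') - mu * norm2 (z - z') ^+ 2.
  by rewrite norm2_sqr /q dotvDl dotvDl !dotvNl dotvZl.
rewrite norm2N (norm2_distC z' z) -(opprB z z') dotvNr qe => H1 H2.
by lra.
Qed.

End SmoothStronglyConvex.

(** Write e = z - x* and q for the gradient of f - mu/2 |. - x*|^2 at z, so that
the new error is (1 - alpha mu) e - alpha q. Expanding its square,
cocoercivity makes the cross term absorb alpha^2 |q|^2. *)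
Lemma gradient_step_contraction {R : realType} {d : nat} (f : 'cV[R]_d -> R)
    (mu L alpha : R) (xstar z : 'cV[R]_d) :
  strongly_convex mu f -> lipschitz_gradient L f -> 0 < mu -> mu <= L ->
  is_minimizer f xstar -> 0 < alpha -> alpha * L < 1 ->
  norm2 (z - alpha *: gradient f z - xstar) <=
  (1 - alpha * mu) * norm2 (z - xstar).
Proof.
move=> f_sc f_lip mu_gt0 muL x_min a_gt0 aL.
have am : alpha * mu < 1 by apply: le_lt_trans aL; rewrite ler_pM2l.
(* With this M cocoercivity balances the terms in q exactly, and
   alpha * L < 1 leaves M + mu above L. *)
pose M := 2 / alpha - 2 * mu.
have aM : alpha * M = 2 * (1 - alpha * mu).
  by rewrite /M mulrBr mulrCA divff ?gt_eqF//; ring.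
have M_gt0 : 0 < M by rewrite -(pmulr_rgt0 _ a_gt0) aM; lra.
have LM : L <= M + mu.
  by rewrite -(ler_pM2l a_gt0) mulrDr aM; have := ler_pM2l a_gt0 mu L; lra.
have := gradient_cocoercive f_sc f_lip mu_gt0 z xstar M_gt0 LM.
rewrite (minimizer_gradient f_sc f_lip mu_gt0 x_min) subr0.
set e := z - xstar; set q := _ - mu *: e => qe.
have -> : z - alpha *: gradient f z - xstar = (1 - alpha * mu) *: e - alpha *: q.
  by rewrite addrAC -/e /q scalerBl scale1r (scalerBr alpha) scalerA opprB
    addrA subrK.
clearbody q e; have am_ge0 : 0 <= 1 - alpha * mu by lra.
rewrite norm2_le_sqr ?mulr_ge0 ?norm2_ge0// exprMn [X in X <= _]norm2_sqr.
rewrite !dotvE (dotvC e q) -!norm2_sqr.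
have : alpha ^+ 2 * norm2 q ^+ 2 <= alpha * (alpha * M) * dotv q e.
  by rewrite -mulrA expr2 -!mulrA !ler_pM2l.
rewrite aM; lra.
Qed.

Section AverageFunction.
Context {R : realType} {n d : nat}.
Variables (f : 'I_n -> 'cV[R]_d -> R) (L : R).
Hypothesis f_diff : forall i z, differentiable (f i) z.

Lemma gradient_average z :
  gradient (average_fun f) z = n%:R^-1 *: \sum_(i < n) gradient (f i) z.
Proof.
apply/matrixP => j k; rewrite !mxE summxE.
have f_der i : derivable (f i) z (delta_mx j 0) by apply: diff_derivable.
have -> : average_fun f = n%:R^-1 \*: (\sum_(i < n) f i).
  by apply/funext => w; rewrite /average_fun fct_sumE.
rewrite deriveZ ?derive_sum//; last exact: derivable_sum.
by congr (_ * _); apply: eq_bigr => i _; rewrite mxE.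
Qed.

Lemma lipschitz_gradient_average : (0 < n)%N ->
  (forall i, lipschitz_gradient L (f i)) -> lipschitz_gradient L (average_fun f).
Proof.
move=> n_gt0 f_lip z z'; rewrite !gradient_average -scalerBr -sumrB norm2Z.
rewrite ger0_norm ?invr_ge0 ?ler0n// ler_pdivrMl ?ltr0n//.
apply: le_trans (norm2_sum _ _) _.
have -> : n%:R * (L * norm2 (z - z')) = \sum_(i < n) L * norm2 (z - z').
  by rewrite sumr_const card_ord mulr_natl.
by apply: ler_sum => i _; exact: f_lip.
Qed.

End AverageFunction.

(** An average over no nodes has zero gradient, which contradicts strong
monotonicity on a nonzero space. *)
Lemma strongly_convex_average_gt0 {R : realType} {n d : nat}
    (f : 'I_n -> 'cV[R]_d -> R) (mu : R) :
  (0 < d)%N -> 0 < mu -> strongly_convex mu (average_fun f) -> (0 < n)%N.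
Proof.
move=> d_gt0 mu_gt0; case: n f => // f f_sc.
have g0 z : gradient (average_fun f) z = 0.
  by rewrite gradient_average ?big_ord0 ?scaler0// => -[].
have f_lip : lipschitz_gradient 0 (average_fun f).
  by move=> z z'; rewrite !g0 subrr norm2_0 mul0r.
have := strong_convexity_le_smoothness f_sc f_lip d_gt0; lra.
Qed.

(** * Spectral radius *)

Section ComplexModulus.
Context {R : realType}.
Notation normc := (@Normc.normc R).

Lemma normc_ge0 (z : R[i]) : 0 <= normc z.
Proof. by case: z => a b; exact: sqrtr_ge0. Qed.

Lemma normc_real (a : R) : normc (real_complex R a) = `|a|.
Proof. by rewrite /= expr0n addr0 sqrtr_sqr. Qed.

Lemma normc_sum (I : Type) (s : seq I) (F : I -> R[i]) :
  normc (\sum_(i <- s) F i) <= \sum_(i <- s) normc (F i).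
Proof.
elim/big_ind2: _ => [|a u b v au bv|//]; first by rewrite Normc.normc0.
exact: le_trans (le_normcD _ _) (lerD au bv).
Qed.

Lemma eigenvalue_roots n (M : 'M[R[i]]_n) : exists s : seq R[i],
  char_poly M = \prod_(z <- s) ('X - z%:P) /\ eigenvalue M =1 mem s.
Proof.
have [s Ms] := closed_field_poly_normal (char_poly M).
move: Ms; rewrite (monicP (char_poly_monic M)) scale1r => Ms.
by exists s; split=> // l; rewrite eigenvalue_root_char Ms root_prod_XsubC.
Qed.

(** Induction on the annihilating product: its first factor gives
B M^(k+1) = B (M - z) M^k + z B M^k, where the first term grows at most like
r^k by induction and |z| < r, so that r^k also dominates the solution of this
scalar recursion. *)
Lemma mx_power_bound_annihilated n (M : 'M[R[i]]_n.+1) (r : R) (s : seq R[i]) B :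
  0 < r -> (forall z, z \in s -> normc z < r) ->
  B * \prod_(z <- s) (M - z%:M) = 0 ->
  exists C : R, 0 <= C /\ forall k i j, normc ((B * M ^+ k) i j) <= C * r ^+ k.
Proof.
move=> r_gt0; elim: s B => [|z s IH] B s_lt.
  rewrite big_nil mulr1 => ->; exists 0; split=> // k i j.
  by rewrite mul0r mxE Normc.normc0 mul0r.
rewrite big_cons mulrA => /IH[|C [C_ge0 BC]].
  by move=> w ws; apply: s_lt; rewrite inE ws orbT.
have zr : 0 < r - normc z by rewrite subr_gt0 s_lt ?mem_head.
(* Any D >= C / (r - |z|) is preserved by the recursion; the sum makes D
   dominate the initial entries. *)
pose D := C / (r - normc z) + \sum_i \sum_j normc (B i j).
have S_ge0 : 0 <= \sum_i \sum_j normc (B i j).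
  by do 2!apply: sumr_ge0 => ? _; exact: normc_ge0.
exists D; split=> [|k]; first by rewrite addr_ge0// divr_ge0// ltW.
elim: k => [|k IHk] i j.
  rewrite expr0 !mulr1 ler_wpDl ?divr_ge0 ?(ltW zr)//.
  rewrite (bigD1 i)//= (bigD1 j)//= -addrA lerDl addr_ge0 ?sumr_ge0// => *.
    exact: normc_ge0.
  by apply: sumr_ge0 => *; exact: normc_ge0.
have -> : B * M ^+ k.+1 = B * (M - z%:M) * M ^+ k + z *: (B * M ^+ k).
  rewrite exprS mulrA mulrBr mulrBl -addrA -[LHS]addr0; congr (_ + _).
  by rewrite -[z%:M]scalemx1 -scalerAr mulr1 -scalerAl addNr.
rewrite mxE [X in _ + X]mxE; apply: le_trans (le_normcD _ _) _.
rewrite Normc.normcM exprS.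
apply: le_trans (lerD (BC k i j) (ler_wpM2l (normc_ge0 z) (IHk i j))) _.
rewrite !mulrA -mulrDl ler_wpM2r ?exprn_ge0 ?(ltW r_gt0)//.
rewrite addrC -lerBrDl (mulrC D) -mulrBl /D mulrDr mulrCA divff ?gt_eqF// mulr1.
by rewrite lerDl mulr_ge0// ltW.
Qed.

(** By Cayley-Hamilton the product of the M - z over the eigenvalues z, counted
with multiplicity, vanishes. *)
Lemma mx_power_bound n (M : 'M[R[i]]_n.+1) (r : R) :
  0 < r -> (forall l, eigenvalue M l -> normc l < r) ->
  exists C : R, 0 <= C /\ forall k i j, normc ((M ^+ k) i j) <= C * r ^+ k.
Proof.
move=> r_gt0 Mr; have [s [Ms sP]] := eigenvalue_roots M.
have [||C [C_ge0 H]] := @mx_power_bound_annihilated n M r s 1 r_gt0.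
- by move=> z zs; apply: Mr; rewrite sP.
- have := Cayley_Hamilton M; rewrite Ms rmorph_prod mul1r => <-.
  by apply: eq_bigr => z _; rewrite rmorphB /= horner_mx_X horner_mx_C.
- by exists C; split=> // k i j; rewrite -[M ^+ k]mul1r.
Qed.

End ComplexModulus.

Section SpectralRadius.
Context {R : realType}.
Notation normc := (@Normc.normc R).

Lemma spectral_radius_ge n (M : 'M[R]_n) l :
  eigenvalue (map_mx (real_complex R) M) l -> normc l <= spectral_radius M.
Proof.
move=> Ml; apply: ub_le_sup; last by exists l.
have [s [_ sP]] := eigenvalue_roots (map_mx (real_complex R) M).
exists (\sum_(z <- s) normc z) => _ [z Mz <-].
rewrite /= sP in Mz; rewrite (big_rem z)//= lerDl.
by apply: sumr_ge0 => *; exact: normc_ge0.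
Qed.

Lemma spectral_radius_ge0 n (M : 'M[R]_n) : 0 <= spectral_radius M.
Proof.
rewrite /spectral_radius; set E := (X in sup X).
have [->|/set0P[_ [l Ml _]]] := eqVneq E set0; first by rewrite sup0.
exact: le_trans (normc_ge0 l) (spectral_radius_ge Ml).
Qed.

(** Collatz-Wielandt bound: if |u| collects the moduli of a left eigenvector for l,
then |u| A v lies between |l| and c times the positive number |u| v. *)
Lemma nonneg_spectral_radius_le n (A : 'M[R]_n) (v : 'I_n -> R) (c : R) :
  (forall i j, 0 <= A i j) -> (forall i, 0 < v i) -> 0 <= c ->
  (forall i, \sum_j A i j * v j <= c * v i) -> spectral_radius A <= c.
Proof.
move=> A_ge0 v_gt0 c_ge0 Av; rewrite /spectral_radius; set E := (X in sup X).
have [->|E0] := eqVneq E set0; first by rewrite sup0.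
apply: ge_sup => [|_ [l /eigenvalueP[u uA u_neq0] <-]]; first exact/set0P.
pose S := \sum_i normc (u 0 i) * v i.
have S_gt0 : 0 < S.
  have [j uj] : exists j, u 0 j != 0 by apply/rV0Pn.
  rewrite /S (bigD1 j)//= ltr_wpDr ?sumr_ge0// => [i _|].
    by rewrite mulr_ge0 ?normc_ge0// ltW.
  rewrite mulr_gt0// lt_def normc_ge0 andbT.
  by apply: contra uj => /eqP/Normc.eq0_normc ->.
rewrite -(ler_pM2r S_gt0) /S !mulr_sumr.
apply: (@le_trans _ _ (\sum_j \sum_i normc (u 0 i) * (A i j * v j))).
  apply: ler_sum => j _; rewrite mulrA -Normc.normcM.
  have -> : l * u 0 j = \sum_i u 0 i * real_complex R (A i j).
    have := congr1 (fun w : 'rV_n => w 0 j) uA; rewrite !mxE => <-.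
    by apply: eq_bigr => i _; rewrite mxE.
  apply: le_trans (ler_wpM2r (ltW (v_gt0 j)) (normc_sum _ _)) _.
  rewrite mulr_suml; apply: ler_sum => i _.
  by rewrite Normc.normcM normc_real ger0_norm// mulrA.
rewrite exchange_big /=; apply: ler_sum => i _.
by rewrite -mulr_sumr mulrCA ler_wpM2l ?normc_ge0.
Qed.

Lemma spectral_radius_power_bound n (A : 'M[R]_n.+1) (r : R) :
  spectral_radius A < r ->
  exists C : R, 0 <= C /\ forall k i j, `|(A ^+ k) i j| <= C * r ^+ k.
Proof.
move=> Ar; have r_gt0 := le_lt_trans (spectral_radius_ge0 A) Ar.
have [|C [C_ge0 H]] := @mx_power_bound _ n (map_mx (real_complex R) A) r r_gt0.
  by move=> l /spectral_radius_ge /le_lt_trans; apply.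
exists C; split=> // k i j; have := H k i j.
by rewrite -rmorphXn mxE normc_real.
Qed.

End SpectralRadius.

(** * Operator norm *)

Section OperatorNorm.
Context {R : realType} {n : nat}.
Variable M : 'M[R]_n.

(** The Frobenius norm bounds the set whose supremum is mxnorm2 M; without an
upper bound that supremum would carry no information. *)
Lemma norm2_mulmx_frobenius (v : 'cV[R]_n) :
  norm2 (M *m v) ^+ 2 <= (\sum_i \sum_j M i j ^+ 2) * norm2 v ^+ 2.
Proof.
rewrite norm2_sqrE mulr_suml; apply: ler_sum => i _.
by rewrite mxE norm2_sumZ_sqr.
Qed.

Lemma mxnorm2_ge (v : 'cV[R]_n) : norm2 v <= 1 -> norm2 (M *m v) <= mxnorm2 M.
Proof.
move=> v1; apply: ub_le_sup; last by exists v.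
have F_ge0 : 0 <= \sum_i \sum_j M i j ^+ 2.
  by do 2!apply: sumr_ge0 => ? _; exact: sqr_ge0.
exists (Num.sqrt (\sum_i \sum_j M i j ^+ 2)) => _ [w /= w1 <-].
rewrite norm2_le_sqr ?sqrtr_ge0// (sqr_sqrtr F_ge0).
apply: le_trans (norm2_mulmx_frobenius w) _.
by rewrite ler_piMr// expr_le1// norm2_ge0.
Qed.

Lemma mxnorm2_ge0 : 0 <= mxnorm2 M.
Proof. by have := @mxnorm2_ge 0; rewrite mulmx0 norm2_0 ler01; apply. Qed.

Lemma norm2_mulmx (v : 'cV[R]_n) : norm2 (M *m v) <= mxnorm2 M * norm2 v.
Proof.
have [v0|v_neq0] := eqVneq (norm2 v) 0.
  by rewrite (norm2_eq0 v0) mulmx0 norm2_0 mulr0.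
have v_gt0 : 0 < norm2 v by rewrite lt_def v_neq0 norm2_ge0.
have := @mxnorm2_ge ((norm2 v)^-1 *: v).
rewrite -scalemxAr !norm2Z ger0_norm ?invr_ge0 ?norm2_ge0// mulVf// lexx.
by rewrite ler_pdivrMl// mulrC; apply.
Qed.

Lemma mxnorm2_eq0 : mxnorm2 M = 0 -> M = 0.
Proof.
move=> M0; apply/matrixP => i j; rewrite mxE.
have := norm2_mulmx (delta_mx j 0); rewrite M0 mul0r => Mj.
have /norm2_eq0/matrixP/(_ i 0) : norm2 (M *m delta_mx j 0) = 0.
  by apply/eqP; rewrite eq_le Mj norm2_ge0.
by rewrite -colE !mxE.
Qed.

End OperatorNorm.

(** * Stacked vectors *)

Section Stacked.
Context {R : realType} {n d : nat}.
Implicit Types (x y : 'cV[R]_(n * d)) (V : 'M[R]_n).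
Notation Z V := (V *t (1%:M : 'M[R]_d)).

Lemma sum_mxtens (F : 'I_(n * d) -> R) :
  \sum_k F k = \sum_i \sum_j F (mxtens_index (i, j)).
Proof.
rewrite (reindex (@mxtens_index n d)) /=; last first.
  by exists (@mxtens_unindex n d) => ? _; rewrite (mxtens_indexK, mxtens_unindexK).
by rewrite pair_bigA; apply: eq_bigr => -[].
Qed.

Lemma blockP x y : (forall i, block x i = block y i) -> x = y.
Proof.
move=> xy; apply/matrixP => k l; rewrite ord1 -(mxtens_unindexK k).
case: (mxtens_unindex k) => i j; have /matrixP/(_ j 0) := xy i.
by rewrite !mxE.
Qed.

Lemma block_stack (v : 'I_n -> 'cV[R]_d) i : block (stack v) i = v i.
Proof. by apply/matrixP => j k; rewrite !mxE ord1 mxtens_indexK. Qed.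

Lemma blockD x y i : block (x + y) i = block x i + block y i.
Proof. by apply/matrixP => j k; rewrite !mxE. Qed.

Lemma blockZ a x i : block (a *: x) i = a *: block x i.
Proof. by apply/matrixP => j k; rewrite !mxE. Qed.

Lemma blockB x y i : block (x - y) i = block x i - block y i.
Proof. by apply/matrixP => j k; rewrite !mxE. Qed.

Lemma block_kron V x i : block (Z V *m x) i = \sum_k V i k *: block x k.
Proof.
apply/matrixP => j l; rewrite !mxE summxE sum_mxtens.
apply: eq_bigr => k _; rewrite (bigD1 j)//= big1 ?addr0 => [|m mj].
  by rewrite tensmxE !mxE eqxx mulr1.
by rewrite tensmxE mxE eq_sym (negPf mj) mulr0 mul0r.
Qed.

Lemma norm2_block x : norm2 x ^+ 2 = \sum_i norm2 (block x i) ^+ 2.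
Proof.
rewrite norm2_sqrE sum_mxtens.
by apply: eq_bigr => i _; rewrite norm2_sqrE; apply: eq_bigr => j _; rewrite mxE.
Qed.

Lemma kron1 : Z 1%:M = 1%:M :> 'M[R]_(n * d).
Proof.
apply/matrixP => k l; rewrite -(mxtens_unindexK k) -(mxtens_unindexK l).
case: (mxtens_unindex k) (mxtens_unindex l) => i j [p q].
by rewrite tensmxE !mxE (can_eq (@mxtens_indexK n d)) xpair_eqE -natrM mulnb.
Qed.

Lemma kronB V V' : Z (V - V') = Z V - Z V'.
Proof. by apply/matrixP => k l; rewrite !mxE mulrBl. Qed.

Lemma kronM V V' : Z (V *m V') = Z V *m Z V'.
Proof. by rewrite tensmx_mul mulmx1. Qed.

(** Each of the d coordinates is mixed across the nodes independently of the
others. *)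
Lemma norm2_kron V x : norm2 (Z V *m x) <= mxnorm2 V * norm2 x.
Proof.
pose slice y j : 'cV[R]_n := \col_i block y i j 0.
have norm2_slice y : norm2 y ^+ 2 = \sum_j norm2 (slice y j) ^+ 2.
  rewrite norm2_block; under eq_bigr => i _ do rewrite norm2_sqrE.
  rewrite exchange_big; apply: eq_bigr => j _; rewrite norm2_sqrE.
  by apply: eq_bigr => i _; rewrite [in RHS]mxE.
have slice_kron j : slice (Z V *m x) j = V *m slice x j.
  apply/matrixP => i k; rewrite mxE block_kron summxE [RHS]mxE.
  by apply: eq_bigr => l _; rewrite mxE [in RHS]mxE.
rewrite norm2_le_sqr ?mulr_ge0 ?norm2_ge0 ?mxnorm2_ge0// exprMn !norm2_slice.
rewrite mulr_sumr; apply: ler_sum => j _; rewrite slice_kron -exprMn.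
by rewrite -norm2_le_sqr ?norm2_mulmx// mulr_ge0 ?norm2_ge0 ?mxnorm2_ge0.
Qed.

Lemma block_meanB x y : block_mean (x - y) = block_mean x - block_mean y.
Proof.
by rewrite /block_mean -scalerBr -sumrB; congr (_ *: _);
  apply: eq_bigr => i _; rewrite blockB.
Qed.

Lemma block_meanD x y : block_mean (x + y) = block_mean x + block_mean y.
Proof.
by rewrite /block_mean -scalerDr -big_split; congr (_ *: _);
  apply: eq_bigr => i _; rewrite blockD.
Qed.

Lemma block_meanZ a x : block_mean (a *: x) = a *: block_mean x.
Proof.
rewrite /block_mean scalerA mulrC -scalerA; congr (_ *: _).
by rewrite scaler_sumr; apply: eq_bigr => i _; rewrite blockZ.
Qed.

Lemma consensusE x : consensus x = Z (averaging_mx n) *m x.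
Proof.
apply: blockP => i; rewrite block_stack block_kron /block_mean scaler_sumr.
by apply: eq_bigr => k _; rewrite mxE.
Qed.

Lemma consensusB x y : consensus (x - y) = consensus x - consensus y.
Proof. by rewrite !consensusE mulmxBr. Qed.

Lemma consensusD x y : consensus (x + y) = consensus x + consensus y.
Proof. by rewrite !consensusE mulmxDr. Qed.

Lemma consensusZ a x : consensus (a *: x) = a *: consensus x.
Proof. by rewrite !consensusE scalemxAr. Qed.

Hypothesis n_gt0 : (0 < n)%N.

Lemma block_mean_consensus x : block_mean (consensus x) = block_mean x.
Proof.
rewrite {1}/block_mean; under eq_bigr => i _ do rewrite block_stack.
by rewrite sumr_const card_ord -[X in _ *: X]scaler_nat scalerA mulVf ?scale1r//
  pnatr_eq0 -lt0n.
Qed.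

Lemma norm2_consensus x : norm2 (consensus x) = Num.sqrt n%:R * norm2 (block_mean x).
Proof.
apply/eqP; rewrite -(@eqrXn2 _ 2) ?mulr_ge0 ?norm2_ge0 ?sqrtr_ge0//.
rewrite exprMn (@sqr_sqrtr _ n%:R) ?ler0n// norm2_block.
under eq_bigr => i _ do rewrite block_stack.
by rewrite sumr_const card_ord mulr_natl.
Qed.

(** Deviations from the mean are orthogonal to constant stacks. *)
Lemma pythagoras_consensus x :
  norm2 x ^+ 2 = norm2 (x - consensus x) ^+ 2 + norm2 (consensus x) ^+ 2.
Proof.
have nmean : \sum_i block x i = n%:R *: block_mean x.
  by rewrite /block_mean scalerA divff ?scale1r// pnatr_eq0 -lt0n.
have dot_mean : \sum_i dotv (block x i) (block_mean x) =
    n%:R * norm2 (block_mean x) ^+ 2.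
  rewrite norm2_sqr -dotvZl -nmean.
  by elim/big_rec2: _ => [|i a b _ ->]; rewrite ?dot0v// dotvDl.
rewrite norm2_consensus exprMn (@sqr_sqrtr _ n%:R) ?ler0n// !norm2_block.
have -> : \sum_i norm2 (block (x - consensus x) i) ^+ 2 =
    \sum_i (norm2 (block x i) ^+ 2 - 2 * dotv (block x i) (block_mean x)
            + norm2 (block_mean x) ^+ 2).
  apply: eq_bigr => i _; rewrite blockB block_stack !norm2_sqr.
  by move: (block x i) (block_mean x) => a b; rewrite !dotvE (dotvC b); ring.
rewrite big_split sumrB /= -mulr_sumr dot_mean sumr_const card_ord -mulr_natl.
by ring.
Qed.

Lemma norm2_deviation x : norm2 (x - consensus x) <= norm2 x.
Proof.
by rewrite norm2_le_sqr ?norm2_ge0// (pythagoras_consensus x) lerDl sqr_ge0.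
Qed.

Lemma norm2_block_mean x : Num.sqrt n%:R * norm2 (block_mean x) <= norm2 x.
Proof.
rewrite -norm2_consensus norm2_le_sqr ?norm2_ge0//.
by rewrite (pythagoras_consensus x) lerDr sqr_ge0.
Qed.

End Stacked.

(** * Mixing operators *)

Section Mixing.
Context {R : realType} {n d : nat}.
Hypothesis n_gt0 : (0 < n)%N.
Implicit Types (P : 'M[R]_(n * d)) (x : 'cV[R]_(n * d)).

(** The only properties of a communication step that the error analysis uses.
They hold for the identity with b = 1 and are stable under composition, which
lets all three methods be treated at once. *)
Definition mixing_operator (b : R) P : Prop :=
  [/\ forall x, consensus (P *m x) = consensus x,
      forall x, P *m consensus x = consensus x &
      forall x, norm2 (P *m x - consensus x) <= b * norm2 (x - consensus x)].

Lemma mixing_operator1 : mixing_operator 1 1%:M.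
Proof. by split=> x; rewrite !mul1mx// mul1r. Qed.

Lemma mixing_operatorM b b' P P' : 0 <= b ->
  mixing_operator b P -> mixing_operator b' P' ->
  mixing_operator (b * b') (P *m P').
Proof.
move=> b_ge0 [P1 P2 P3] [P1' P2' P3']; split=> x; rewrite -mulmxA.
- by rewrite P1.
- by rewrite P2'.
have := P3 (P' *m x); rewrite P1' => /le_trans; apply.
by rewrite -mulrA ler_wpM2l.
Qed.

Lemma mixing_operatorX b P k : 0 <= b ->
  mixing_operator b P -> mixing_operator (b ^+ k) (P ^+ k).
Proof.
move=> b_ge0 Pb; elim: k => [|k IH]; first exact: mixing_operator1.
by rewrite !exprS; exact: mixing_operatorM.
Qed.

(** The averaging matrix J satisfies J W = W J = J J = J, so on deviations from
the mean W acts as W - J, whose norm is the mixing rate. *)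
Lemma mixing_matrix_operator (W : 'M[R]_n) : doubly_stochastic W ->
  mixing_operator (mixing_rate W) (W *t (1%:M : 'M[R]_d)).
Proof.
case=> _ rowW colW; set J : 'M[R]_n := averaging_mx n.
have WJ : W *m J = J.
  apply/matrixP => i j; rewrite !mxE.
  under eq_bigr => k _ do rewrite mxE.
  by rewrite -mulr_suml rowW mul1r.
have JW : J *m W = J.
  apply/matrixP => i j; rewrite !mxE.
  under eq_bigr => k _ do rewrite mxE.
  by rewrite -mulr_sumr colW mulr1.
have JJ : J *m J = J.
  apply/matrixP => i j; rewrite !mxE.
  under eq_bigr => k _ do rewrite !mxE.
  rewrite sumr_const card_ord -[LHS]mulr_natl mulrA mulfV ?mul1r//.
  by rewrite pnatr_eq0 -lt0n.
split=> x.
- by rewrite !consensusE mulmxA -kronM JW.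
- by rewrite !consensusE mulmxA -kronM WJ.
apply: le_trans (norm2_kron (W - J) (x - consensus x)).
suff -> : (W *t 1%:M) *m x - consensus x =
  ((W - J) *t (1%:M : 'M[R]_d)) *m (x - consensus x) by [].
rewrite mulmxBr !consensusE mulmxA -kronM mulmxBl WJ JJ subrr kronB mulmxBl.
by rewrite tens0mx mul0mx subr0.
Qed.

Lemma mixing_block_mean b P x :
  mixing_operator b P -> block_mean (P *m x) = block_mean x.
Proof.
by case=> cP _ _; rewrite -(block_mean_consensus n_gt0) cP block_mean_consensus.
Qed.

End Mixing.

(** * One step of gradient tracking *)

Section OneStep.
Context {R : realType} {n d : nat}.
Variables (f : 'I_n -> 'cV[R]_d -> R) (mu L alpha : R) (xstar : 'cV[R]_d).
Hypothesis n_gt0 : (0 < n)%N.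
Hypothesis f_diff : forall i z, differentiable (f i) z.
Hypothesis mu_gt0 : 0 < mu.
Hypothesis muL : mu <= L.
Hypothesis f_sc : strongly_convex mu (average_fun f).
Hypothesis f_lip : forall i, lipschitz_gradient L (f i).
Hypothesis xstar_min : is_minimizer (average_fun f) xstar.
Hypothesis alpha_gt0 : 0 < alpha.
Hypothesis alphaL : alpha * L < 1.
Notation G := (stacked_gradient f).
Notation F := (average_fun f).
Notation sqn := (Num.sqrt (n%:R : R)).
Implicit Types x y : 'cV[R]_(n * d).

Lemma smoothness_ge0 : 0 <= L. Proof. exact: le_trans (ltW mu_gt0) muL. Qed.

Lemma sqrt_nodes_gt0 : 0 < sqn. Proof. by rewrite sqrtr_gt0 ltr0n. Qed.

Lemma stacked_gradient_lipschitz x x' : norm2 (G x - G x') <= L * norm2 (x - x').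
Proof.
rewrite norm2_le_sqr ?mulr_ge0 ?norm2_ge0 ?smoothness_ge0// exprMn.
rewrite !norm2_block mulr_sumr.
apply: ler_sum => i _; rewrite !blockB !block_stack -exprMn.
by rewrite -norm2_le_sqr ?f_lip// mulr_ge0 ?norm2_ge0 ?smoothness_ge0.
Qed.

Lemma block_mean_gradient_consensus x :
  block_mean (G (consensus x)) = gradient F (block_mean x).
Proof.
rewrite gradient_average//; congr (_ *: _); apply: eq_bigr => i _.
by rewrite !block_stack.
Qed.

(** The factor sqrt n is gained because averaging n blocks contracts the stacked
norm by it. *)
Lemma norm2_mean_gradient_gap x :
  sqn * norm2 (block_mean (G x) - gradient F (block_mean x)) <=
  L * norm2 (x - consensus x).
Proof.
rewrite -block_mean_gradient_consensus -block_meanB.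
exact: le_trans (norm2_block_mean n_gt0 _) (stacked_gradient_lipschitz _ _).
Qed.

Lemma norm2_mean_gradient x :
  norm2 (gradient F (block_mean x)) <= L * norm2 (block_mean x - xstar).
Proof.
have F_lip := lipschitz_gradient_average f_diff n_gt0 f_lip.
have := F_lip (block_mean x) xstar.
by rewrite (minimizer_gradient f_sc F_lip mu_gt0 xstar_min) subr0.
Qed.

Variables (b p q : R) (P1 P2 P3 P4 : 'M[R]_(n * d)).
Hypothesis b_le1 : b <= 1.
Hypothesis p_le1 : p <= 1.
Hypothesis q_ge0 : 0 <= q.
Hypothesis mix1 : mixing_operator b P1.
Hypothesis mix2 : mixing_operator p P2.
Hypothesis mix3 : mixing_operator b P3.
Hypothesis mix4 : mixing_operator q P4.

Variables x y : 'cV[R]_(n * d).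
Let x' := P1 *m x - alpha *: (P2 *m y).
Let y' := P3 *m y + P4 *m (G x' - G x).
Hypothesis tracking : block_mean y = block_mean (G x).

(** The invariant that gives gradient tracking its name: the mean of y remains
the mean of the local gradients. *)
Lemma tracking_step z :
  block_mean (P3 *m y + P4 *m (G z - G x)) = block_mean (G z).
Proof.
rewrite block_meanD (mixing_block_mean n_gt0 _ mix3) (mixing_block_mean n_gt0 _ mix4).
by rewrite block_meanB tracking subrKC.
Qed.

(** The means follow an inexact gradient step on the average function; the
inexactness is the gap between the mean of the local gradients and the
gradient at the mean. *)
Lemma optimality_error_step :
  norm2 (block_mean x' - xstar) <=
  (1 - alpha * mu) * norm2 (block_mean x - xstar)
  + alpha * L / sqn * norm2 (x - consensus x).
Proof.
rewrite /x' block_meanB block_meanZ (mixing_block_mean n_gt0 _ mix1).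
rewrite (mixing_block_mean n_gt0 _ mix2) tracking.
have -> : block_mean x - alpha *: block_mean (G x) - xstar =
    (block_mean x - alpha *: gradient F (block_mean x) - xstar)
    - alpha *: (block_mean (G x) - gradient F (block_mean x)).
  move: (block_mean x) (block_mean (G x)) => u v.
  by move: (gradient F u) => w; apply/matrixP => i j; rewrite !mxE; ring.
apply: le_trans (norm2B _ _) _; apply: lerD.
  apply: (@gradient_step_contraction _ _ _ _ L) => //.
  exact: lipschitz_gradient_average f_diff n_gt0 f_lip.
rewrite norm2Z gtr0_norm// -!mulrA ler_pM2l// mulrCA ler_pdivlMl ?sqrt_nodes_gt0//.
exact: norm2_mean_gradient_gap.
Qed.

Lemma consensus_error_step :
  norm2 (x' - consensus x') <=
  b * norm2 (x - consensus x) + alpha * p * norm2 (y - consensus y).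
Proof.
case: mix1 => c1 _ d1; case: mix2 => c2 _ d2.
rewrite /x' consensusB consensusZ c1 c2.
have -> : P1 *m x - alpha *: (P2 *m y) - (consensus x - alpha *: consensus y) =
  (P1 *m x - consensus x) - alpha *: (P2 *m y - consensus y).
  move: (P1 *m x) (P2 *m y) (consensus x) (consensus y) => u v w z.
  by apply/matrixP => i j; rewrite !mxE; ring.
apply: le_trans (norm2B _ _) _; apply: lerD; first exact: d1.
by rewrite norm2Z gtr0_norm// -mulrA ler_pM2l.
Qed.

(** P1 moves x only through its deviation from consensus, by at most (1 + b) times
that deviation. The step along y splits into the deviation of y and its mean,
which by tracking is the gradient at the mean up to the consensus error. *)
Lemma displacement_le :
  norm2 (x' - x) <= alpha * sqn * L * norm2 (block_mean x - xstar)
    + (2 + alpha * L) * norm2 (x - consensus x)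
    + alpha * norm2 (y - consensus y).
Proof.
case: mix1 => c1 _ d1; case: mix2 => c2 _ d2.
have -> : x' - x = (P1 *m x - consensus x) - (x - consensus x)
   - alpha *: ((P2 *m y - consensus y) + consensus y).
  by rewrite subrK opprB addrA subrK addrAC.
apply: le_trans (norm2B _ _) _.
apply: le_trans (lerD (norm2B _ _) (lexx _)) _.
rewrite norm2Z gtr0_norm//.
have H1 := le_trans (d1 x) (ler_wpM2r (norm2_ge0 _) b_le1).
have H2 := le_trans (d2 y) (ler_wpM2r (norm2_ge0 _) p_le1).
have H3 := norm2D (P2 *m y - consensus y) (consensus y).
have H4 : norm2 (consensus y) <=
    L * norm2 (x - consensus x) + sqn * (L * norm2 (block_mean x - xstar)).
  rewrite norm2_consensus// tracking.
  rewrite -[block_mean (G x)](subrK (gradient F (block_mean x))).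
  apply: le_trans (ler_wpM2l (ltW sqrt_nodes_gt0) (norm2D _ _)) _.
  rewrite mulrDr lerD ?norm2_mean_gradient_gap// ler_pM2l ?sqrt_nodes_gt0//.
  exact: norm2_mean_gradient.
have H5 : alpha * norm2 (P2 *m y - consensus y + consensus y) <=
  alpha * (norm2 (y - consensus y) + (L * norm2 (x - consensus x) +
    sqn * (L * norm2 (block_mean x - xstar)))).
  by rewrite ler_pM2l// (le_trans H3)// lerD// (le_trans H2)// mul1r.
by lra.
Qed.

Lemma tracking_error_step :
  norm2 (y' - consensus y') <=
  q * sqn * alpha * L ^+ 2 * norm2 (block_mean x - xstar)
  + q * L * (2 + alpha * L) * norm2 (x - consensus x)
  + (b + q * alpha * L) * norm2 (y - consensus y).
Proof.
case: mix3 => c3 _ d3; case: mix4 => c4 _ d4.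
rewrite /y' consensusD c3 c4 opprD addrACA.
apply: le_trans (norm2D _ _) _.
have H1 := d4 (G x' - G x).
have H2 : norm2 (G x' - G x - consensus (G x' - G x)) <= L * norm2 (x' - x).
  exact: le_trans (norm2_deviation n_gt0 _) (stacked_gradient_lipschitz _ _).
have H3 := ler_wpM2l q_ge0 (le_trans H2 (ler_wpM2l smoothness_ge0 displacement_le)).
have H4 := d3 y.
apply: le_trans (lerD H4 (le_trans H1 H3)) _.
by rewrite le_eqVlt; apply/orP; left; apply/eqP; ring.
Qed.

End OneStep.

(** * Nonnegative linear recursions *)

Section NonnegativeRecursion.
Context {R : realType} {n : nat}.
Variable A : 'M[R]_n.+1.
Hypothesis A_ge0 : forall i j, 0 <= A i j.

(** Strictness in each of the finitely many rows leaves a common margin. *)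
Lemma nonneg_spectral_radius_lt1 (v : 'I_n.+1 -> R) :
  (forall i, 0 < v i) -> (forall i, \sum_j A i j * v j < v i) ->
  spectral_radius A < 1.
Proof.
move=> v_gt0 Av; pose c := \big[Num.max/0]_i ((\sum_j A i j * v j) / v i).
have c_lt1 : c < 1.
  by apply: bigmax_lt => // i _; rewrite ltr_pdivrMr// mul1r.
apply: le_lt_trans c_lt1; apply: (nonneg_spectral_radius_le A_ge0 v_gt0).
  exact: bigmax_ge_id.
by move=> i; rewrite -ler_pdivrMr//; exact: (le_bigmax _ (fun i => _ / v i)).
Qed.

Lemma nonneg_recursion_le_power (r : nat -> 'cV[R]_n.+1) :
  (forall k i, r k.+1 i 0 <= (A *m r k) i 0) ->
  forall k i, r k i 0 <= (A ^+ k *m r 0%N) i 0.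
Proof.
move=> r_le; elim=> [|k IH] i; first by rewrite expr0 mul1mx.
apply: le_trans (r_le k i) _; rewrite exprS -[A * _]/(A *m _) -mulmxA.
by rewrite mxE [leRHS]mxE; apply: ler_sum => j _; rewrite ler_wpM2l.
Qed.

(** Nonnegativity of A iterates the entrywise inequality to r k <= A^k r 0, and
the entries of A^k are bounded by a multiple of t^k. *)
Lemma nonneg_recursion_rate (t : R) : spectral_radius A < t ->
  exists C : R, 0 < C /\ forall r : nat -> 'cV[R]_n.+1,
    (forall k i, 0 <= r k i 0) ->
    (forall k i, r k.+1 i 0 <= (A *m r k) i 0) ->
    forall k, norm2 (r k) <= C * t ^+ k * norm2 (r 0%N).
Proof.
move=> At; have t_gt0 := le_lt_trans (spectral_radius_ge0 A) At.
have [C [C_ge0 AC]] := spectral_radius_power_bound At.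
exists (\sum_(i < n.+1) \sum_(j < n.+1) C + 1); split=> [|r r_ge0 r_le k].
  by rewrite ltr_wpDl// sumr_ge0// => i _; rewrite sumr_ge0.
have t_ge0 : 0 <= t ^+ k * norm2 (r 0%N).
  by rewrite mulr_ge0 ?norm2_ge0// exprn_ge0// ltW.
rewrite -mulrA mulrDl mul1r; apply: ler_wpDr => //.
apply: le_trans (norm2_le_sum _) _; rewrite mulr_suml; apply: ler_sum => i _.
rewrite ger0_norm//; apply: le_trans (nonneg_recursion_le_power r_le k i) _.
rewrite mxE mulr_suml; apply: ler_sum => j _; rewrite mulrA.
apply: le_trans (ler_norm _) _; rewrite normrM.
by apply: ler_pM => //; exact: coord_le_norm2.
Qed.

End NonnegativeRecursion.

(** * Step sizes *)

Section StepSize.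
Context {R : realType}.

(** The right-hand side of the bound on a is the positive root of
Q X^2 + P X - S, T being its discriminant divided by P^2. *)
Lemma quadratic_of_sqrt_bound (P Q Q2 S T a : R) :
  0 < P -> 0 < Q -> 0 < a -> Q2 = 2 * Q -> P ^+ 2 * (T - 1) = 4 * Q * S ->
  a < P / Q2 * (Num.sqrt T - 1) -> Q * a ^+ 2 + P * a < S.
Proof.
move=> P_gt0 Q_gt0 a_gt0 -> PT.
rewrite mulrAC ltr_pdivlMr ?mulr_gt0// => aT; set X := Num.sqrt T in aT.
have PX : 2 * Q * a + P < P * X by lra.
have PX0 : 0 < 2 * Q * a + P by rewrite addr_gt0 ?mulr_gt0.
have X_gt0 : 0 < X by rewrite -(pmulr_rgt0 _ P_gt0); exact: lt_trans PX0 PX.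
have XT : X ^+ 2 = T by rewrite sqr_sqrtr// ltW// -sqrtr_gt0.
have : (2 * Q * a + P) ^+ 2 < (P * X) ^+ 2.
  by rewrite ltr_pXn2r// nnegrE ltW// (lt_trans PX0).
rewrite exprMn XT => H; rewrite -(ltr_pM2l Q_gt0).
have : P ^+ 2 * T = 4 * Q * S + P ^+ 2 by rewrite -PT; ring.
by lra.
Qed.

(** The contraction factors of the mixing operators applied to y in the update of
x, and to the gradient increments in the update of y. The other two operators
have factor b in all three methods. *)
Definition gta_rates (m : gta) (b : R) : R * R :=
  match m with GTA1 => (1, 1) | GTA2 => (b, 1) | GTA3 => (b, b) end.

Lemma gta_error_mx_mulE m n (mu L alpha b u v w : R) (i : 'I_3) :
  let p := (gta_rates m b).1 in
  let q := (gta_rates m b).2 in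
  let s := Num.sqrt (n%:R : R) in
  \sum_j gta_error_mx m n mu L alpha b i j * [:: u; v; w]`_j =
  [:: (1 - alpha * mu) * u + alpha * L / s * v;
      b * v + alpha * p * w;
      q * s * alpha * L ^+ 2 * u + q * L * (2 + alpha * L) * v
        + (b + q * alpha * L) * w]`_i.
Proof.
by case: m; case: i => [[|[|[|//]]] ?];
  rewrite !big_ord_recl big_ord0 !mxE /=; ring.
Qed.

Variables (m : gta) (n : nat) (mu L alpha b : R).
Hypothesis n_gt0 : (0 < n)%N.
Hypothesis mu_gt0 : 0 < mu.
Hypothesis muL : mu <= L.
Hypothesis alpha_gt0 : 0 < alpha.
Hypothesis b_gt0 : 0 < b.
Hypothesis alpha_lt : alpha < gta_step_bound m mu L b.
Let p := (gta_rates m b).1.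
Let q := (gta_rates m b).2.

(** The conditions b < 1 and q alpha L < 1 - b make the diagonal entries of A
smaller than 1, and alpha L < 1 makes 1 - alpha mu nonnegative. The last
condition is det (I - A) > 0 divided by alpha mu; the step size bounds with a
square root are the positive roots of this quadratic in alpha. *)
Lemma gta_step_conditions :
  [/\ b < 1, alpha * L < 1, q * (alpha * L) < 1 - b &
      q * (1 - b + 2 * p) * (alpha * L)
        + p * q * (L / mu + 1) * (alpha * L) ^+ 2 < (1 - b) ^+ 2].
Proof.
have L_gt0 : 0 < L := lt_le_trans mu_gt0 muL.
have L_neq0 : L != 0 by rewrite gt_eqF.
have mu_neq0 : mu != 0 by rewrite gt_eqF.
have b_neq0 : b != 0 by rewrite gt_eqF.
have Q_gt0 : 0 < L / mu * (L + mu) by rewrite mulr_gt0 ?divr_gt0 ?addr_gt0.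
have aL_gt0 : 0 < alpha * L by rewrite mulr_gt0.
have b0 := b_gt0; have b1_neq0 : 1 + b != 0 by rewrite gt_eqF// addr_gt0.
have Qb_gt0 : 0 < L / mu * (L + mu) * b by rewrite mulr_gt0.
move: alpha_lt; rewrite /p /q; clear p q alpha_lt; case: m => /=; rewrite !lt_min.
- rewrite ltr_pdivlMr// => /andP[aL]; have b_lt1 : b < 1 by lra.
  have P_gt0 : 0 < 3 - b by lra.
  have P_neq0 : 3 - b != 0 by rewrite gt_eqF.
  move/(@quadratic_of_sqrt_bound _ (L / mu * (L + mu)) _ ((1 - b) ^+ 2 / L)).
  move=> /(_ P_gt0 Q_gt0 alpha_gt0) H.
  have {}H : (L / mu * (L + mu) * alpha ^+ 2 + (3 - b) * alpha) < (1 - b) ^+ 2 / L.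
    by apply: H; field; rewrite ?L_neq0 ?mu_neq0 ?P_neq0.
  rewrite ltr_pdivlMr// in H; split; rewrite ?mul1r//; first by lra.
  by apply: le_lt_trans H; rewrite le_eqVlt; apply/orP; left; apply/eqP; field.
- rewrite ltr_pdivlMr// => /andP[aL]; have b_lt1 : b < 1 by lra.
  have P_gt0 : 0 < 1 + b by lra.
  move/(@quadratic_of_sqrt_bound _ (L / mu * (L + mu) * b) _ ((1 - b) ^+ 2 / L)).
  move=> /(_ P_gt0 Qb_gt0 alpha_gt0) H.
  have {}H : (L / mu * (L + mu) * b * alpha ^+ 2 + (1 + b) * alpha) <
      (1 - b) ^+ 2 / L.
    by apply: H; field; rewrite ?L_neq0 ?mu_neq0 ?b1_neq0.
  rewrite ltr_pdivlMr// in H; split; rewrite ?mul1r//; first by lra.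
  by apply: le_lt_trans H; rewrite le_eqVlt; apply/orP; left; apply/eqP; field.
- have Lb_gt0 : 0 < L * b by rewrite mulr_gt0.
  rewrite !ltr_pdivlMr// => /and3P[aL aLb]; have b_lt1 : b < 1.
    by have := mulr_gt0 alpha_gt0 Lb_gt0; lra.
  have P_gt0 : 0 < 1 + b by lra.
  move/(@quadratic_of_sqrt_bound _ (L / mu * (L + mu) * b) _
    ((1 - b) ^+ 2 / (L * b))).
  move=> /(_ P_gt0 Qb_gt0 alpha_gt0) H.
  have {}H : (L / mu * (L + mu) * b * alpha ^+ 2 + (1 + b) * alpha) <
      (1 - b) ^+ 2 / (L * b).
    by apply: H; field; rewrite ?L_neq0 ?mu_neq0 ?b1_neq0 ?b_neq0.
  rewrite ltr_pdivlMr// in H; split=> //; first by lra.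
  by apply: le_lt_trans H; rewrite le_eqVlt; apply/orP; left; apply/eqP; field.
Qed.

Lemma gta_error_mx_ge0 i j : 0 <= gta_error_mx m n mu L alpha b i j.
Proof.
have [b_lt1 aL _ _] := gta_step_conditions.
have L_ge0 : 0 <= L by apply: le_trans muL; exact: ltW.
have a_ge0 := ltW alpha_gt0; have b_ge0 := ltW b_gt0.
have aL_ge0 : 0 <= alpha * L by rewrite mulr_ge0.
have amu : 0 <= 1 - alpha * mu.
  by have := ler_wpM2l a_ge0 muL; lra.
rewrite mxE; case: m; case: i => [[|[|[|//]]] ?]; case: j => [[|[|[|//]]] ?] /=;
  repeat first [ done | exact: sqrtr_ge0 | exact: sqr_ge0 | rewrite invr_ge0
               | apply: mulr_ge0 | apply: addr_ge0 ].
Qed.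

(** By the Collatz-Wielandt bound it suffices to find a positive vector (u, 1, w)
that A strictly decreases. The first row asks for u above a threshold, the
second for w below one, and the third for w large compared to u; the
determinant condition says exactly that these are compatible. *)
Lemma gta_spectral_radius_lt1 : spectral_radius (gta_error_mx m n mu L alpha b) < 1.
Proof.
have [b_lt1 aL qaL det_gt0] := gta_step_conditions.
have L_gt0 : 0 < L := lt_le_trans mu_gt0 muL.
have [p_gt0 q_gt0] : 0 < p /\ 0 < q by rewrite /p /q; case: m.
pose s := Num.sqrt (n%:R : R); have s_gt0 : 0 < s by rewrite sqrtr_gt0 ltr0n.
pose k := L / mu; have k_gt0 : 0 < k by rewrite divr_gt0.
pose D := 1 - b - q * (alpha * L); have D_gt0 : 0 < D by rewrite subr_gt0.
have ap_gt0 : 0 < alpha * p by rewrite mulr_gt0.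
have c_gt0 : 0 < q * s * alpha * L ^+ 2 by rewrite !mulr_gt0 ?exprn_gt0.
(* The value that w must exceed when u is at its own threshold k / s. *)
pose lo := (q * alpha * L ^+ 2 * k + q * L * (2 + alpha * L)) / D.
have lo_hi : lo < (1 - b) / (alpha * p).
  rewrite /lo ltr_pdivrMr// [ltRHS]mulrAC ltr_pdivlMr// /D.
  by rewrite -/k in det_gt0; lra.
pose w := (lo + (1 - b) / (alpha * p)) / 2.
have [lo_w w_hi] := midf_lt lo_hi; rewrite -/w in lo_w w_hi.
have N_gt0 : 0 < q * alpha * L ^+ 2 * k + q * L * (2 + alpha * L).
  have aL_gt0 : 0 < alpha * L by rewrite mulr_gt0.
  apply: addr_gt0; first by rewrite (mulr_gt0 _ k_gt0)// !mulr_gt0.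
  by rewrite (mulr_gt0 (mulr_gt0 q_gt0 L_gt0))// addr_gt0.
rewrite /lo ltr_pdivrMr// in lo_w; rewrite ltr_pdivlMr// in w_hi.
have hi1 : k / s < (w * D - q * L * (2 + alpha * L)) / (q * s * alpha * L ^+ 2).
  rewrite ltr_pdivlMr// [X in X < _](_ : _ = q * alpha * L ^+ 2 * k); first by lra.
  by field; rewrite gt_eqF.
pose u := (k / s + (w * D - q * L * (2 + alpha * L)) / (q * s * alpha * L ^+ 2)) / 2.
have [k_u u_hi] := midf_lt hi1; rewrite -/u in k_u u_hi.
have u_gt0 : 0 < u by rewrite (lt_trans _ k_u)// divr_gt0.
rewrite ltr_pdivlMr// in u_hi.
have w_gt0 : 0 < w.
  by rewrite -(pmulr_lgt0 _ D_gt0) (lt_trans N_gt0).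
apply: (@nonneg_spectral_radius_lt1 _ _ _ _ (fun i => [:: u; 1; w]`_i)).
- exact: gta_error_mx_ge0.
- by case=> [[|[|[|//]]] ?].
move=> i; rewrite gta_error_mx_mulE -/p -/q -/s.
case: i => [[|[|[|//]]] ?] /=.
- have -> : alpha * L / s = alpha * mu * (k / s) by rewrite /k; field;
    rewrite !gt_eqF.
  have : alpha * mu * (k / s) < alpha * mu * u by rewrite ltr_pM2l// mulr_gt0.
  by lra.
- by lra.
- by rewrite /D in u_hi; lra.
Qed.

End StepSize.

(** * Convergence of gradient tracking *)

Section GradientTracking.
Context {R : realType} {n d : nat}.
Variables (m : gta) (f : 'I_n -> 'cV[R]_d -> R) (mu L alpha : R).
Variables (xstar : 'cV[R]_d) (W : 'M[R]_n) (nc : nat).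
Hypothesis n_gt0 : (0 < n)%N.
Hypothesis f_diff : forall i z, differentiable (f i) z.
Hypothesis mu_gt0 : 0 < mu.
Hypothesis muL : mu <= L.
Hypothesis f_sc : strongly_convex mu (average_fun f).
Hypothesis f_lip : forall i, lipschitz_gradient L (f i).
Hypothesis xstar_min : is_minimizer (average_fun f) xstar.
Hypothesis W_ds : doubly_stochastic W.
Hypothesis alpha_gt0 : 0 < alpha.
Hypothesis beta_gt0 : 0 < mixing_rate W.
Notation bnc := (mixing_rate W ^+ nc).
Hypothesis alpha_lt : alpha < gta_step_bound m mu L bnc.
Notation rate2 := (gta_rates m bnc).1.
Notation rate4 := (gta_rates m bnc).2.
Variables x y : nat -> 'cV[R]_(n * d).
Hypothesis xy_gta : gta_iterates m f W nc alpha x y.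

Lemma gta_iterates_mixing : exists P1 P2 P3 P4 : 'M[R]_(n * d),
  [/\ mixing_operator bnc P1, mixing_operator rate2 P2, mixing_operator bnc P3 &
      mixing_operator rate4 P4] /\
  forall k, x k.+1 = P1 *m x k - alpha *: (P2 *m y k) /\
    y k.+1 = P3 *m y k
      + P4 *m (stacked_gradient f (x k.+1) - stacked_gradient f (x k)).
Proof.
have mixW : mixing_operator bnc ((W *t (1%:M : 'M[R]_d)) ^+ nc).
  by apply: mixing_operatorX (ltW beta_gt0) _; exact: mixing_matrix_operator.
have mix1 : mixing_operator 1 (((1%:M : 'M[R]_n) *t (1%:M : 'M[R]_d)) ^+ nc).
  rewrite kron1; have := mixing_operatorX nc ler01 (@mixing_operator1 R n d).
  by rewrite (expr1n R).
by case: m xy_gta => -[_ xy]; do 4!eexists; (split; last exact: xy).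
Qed.

Lemma gta_error_recursion k i :
  error_vector xstar (x k.+1) (y k.+1) i 0 <=
  (gta_error_mx m n mu L alpha bnc *m error_vector xstar (x k) (y k)) i 0.
Proof.
have b_gt0 : 0 < bnc by rewrite exprn_gt0.
have [b_lt1 aL _ _] := gta_step_conditions mu_gt0 muL alpha_gt0 b_gt0 alpha_lt.
have [P1 [P2 [P3 [P4 [[mix1 mix2 mix3 mix4] xyS]]]]] := gta_iterates_mixing.
have y0 : y 0%N = stacked_gradient f (x 0%N) by case: m xy_gta => -[].
have [p_le1 q_ge0] : rate2 <= 1 /\ 0 <= rate4.
  by case: (m) => /=; rewrite ?ler01 ?lexx ?(ltW b_gt0) ?(ltW b_lt1).
have tracking : block_mean (y k) = block_mean (stacked_gradient f (x k)).
  elim: k => [|k IH]; first by rewrite y0.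
  have [_ yk] := xyS k; rewrite yk.
  exact: (tracking_step n_gt0 mix3 mix4 IH).
rewrite [leRHS]mxE; under eq_bigr => j _ do rewrite [X in _ * X]mxE.
rewrite gta_error_mx_mulE mxE; have [-> ->] := xyS k.
case: i => [[|[|[|//]]] ?] /=.
- exact: (optimality_error_step n_gt0 f_diff mu_gt0 muL f_sc f_lip xstar_min
    alpha_gt0 aL mix1 mix2 tracking).
- exact: consensus_error_step.
- exact: (tracking_error_step n_gt0 f_diff mu_gt0 muL f_sc f_lip xstar_min
    alpha_gt0 (ltW b_lt1) p_le1 q_ge0 mix1 mix2 mix3 mix4 tracking).
Qed.

End GradientTracking.

Theorem corollary5 (R : realType) (n d : nat) (d_gt0 : (0 < d)%N)
    (f : 'I_n -> 'cV[R]_d -> R) (mu L : R) (xstar : 'cV[R]_d)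
    (E : rel 'I_n) (W : 'M[R]_n) (nc : nat)
    (f_diff : forall (i : 'I_n) (z : 'cV[R]_d), differentiable (f i) z)
    (mu_gt0 : 0 < mu)
    (f_sc : strongly_convex mu (average_fun f))
    (f_lip : forall i, lipschitz_gradient L (f i))
    (xstar_min : is_minimizer (average_fun f) xstar)
    (E_conn : connected_network E)
    (W_mix : mixing_matrix E W)
    (W_neq : W <> averaging_mx n)
    (nc_ge1 : (1 <= nc)%N)
    (m : gta) (alpha : R) (alpha_gt0 : 0 < alpha)
    (alpha_lt : alpha < gta_step_bound m mu L (mixing_rate W ^+ nc)) :
  let A := gta_error_mx m n mu L alpha (mixing_rate W ^+ nc) in
  spectral_radius A < 1 /\
  forall eps : R, 0 < eps ->
    exists C : R, 0 < C /\
      forall x y : nat -> 'cV[R]_(n * d),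
        gta_iterates m f W nc alpha x y ->
        forall k : nat,
          norm2 (error_vector xstar (x k) (y k)) <=
          C * (spectral_radius A + eps) ^+ k *
          norm2 (error_vector xstar (x 0%N) (y 0%N)).
Proof.
move=> A; have n_gt0 := strongly_convex_average_gt0 d_gt0 mu_gt0 f_sc.
have f_lip_avg := lipschitz_gradient_average f_diff n_gt0 f_lip.
have muL := strong_convexity_le_smoothness f_sc f_lip_avg d_gt0.
have [_ W_ds _ _ _] := W_mix.
have beta_gt0 : 0 < mixing_rate W.
  rewrite lt_def mxnorm2_ge0 andbT; apply/eqP => /mxnorm2_eq0/eqP.
  by rewrite subr_eq0 => /eqP.
have b_gt0 : 0 < mixing_rate W ^+ nc by rewrite exprn_gt0.
split=> [|eps eps_gt0]; first exact: gta_spectral_radius_lt1.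
have A_ge0 : forall i j, 0 <= A i j by apply: gta_error_mx_ge0.
have Aeps : spectral_radius A < spectral_radius A + eps by rewrite ltrDl.
have [C [C_gt0 AC]] := nonneg_recursion_rate A_ge0 Aeps.
exists C; split=> // x y xy k.
apply: (AC (fun k => error_vector xstar (x k) (y k))) => {}k i.
  by rewrite mxE; case: i => [[|[|[|//]]] ?]; exact: norm2_ge0.
exact: gta_error_recursion.
Qed.
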